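(* Let $\Omega\subseteq\mathbb{S}^2$ be a domain with surface area $|\Omega|$. For all $\lambda\ge0$ $$F_{\mathbb{S}^2}(\lambda):=\frac{|\Omega|}{4\pi}\sum_{n=0}^\infty\bigl(\lambda-n(n+1)\bigr)_+(2n+1)\ge\frac1{8\pi}|\Omega|\lambda^2=\mathrm{L}^{\mathrm{cl}}_{1,2}|\Omega|\lambda^2,$$ while $$F_{\mathbb{S}^2}(\lambda)=\frac1{8\pi}|\Omega|\lambda^2\quad\text{for}\quad\lambda=N(N+1),\ N=0,1,\dots.$$
   Context: $\mathbb{S}^2$ is the unit sphere in $\mathbb{R}^3$, a domain is a nonempty connected open set, $x_+=\max(0,x)$, and $\mathrm{L}^{\mathrm{cl}}_{1,2}=\frac1{(2\pi)^2}\int_{\mathbb{R}^2}(1-|\xi|^2)_+\,d\xi$. *)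

(* Defs.v *)
From HB Require Import structures.
From mathcomp Require Import all_boot all_order all_algebra.
From mathcomp Require Import all_classical all_reals all_analysis.
Set Implicit Arguments.
Unset Strict Implicit.
Unset Printing Implicit Defensive.
Import Order.TTheory GRing.Theory Num.Theory.
Import numFieldNormedType.Exports.
Local Open Scope classical_set_scope.
Local Open Scope ring_scope.

Definition posp {R : realType} (x : R) : R := Num.max 0 x.

Definition sphere2 {R : realType} : set 'rV[R]_3 :=
  [set x | \sum_(i < 3) x 0 i ^+ 2 = 1].

(* [connected] refers to the topology induced on the set itself, so it does not
   matter that it is read in the ambient space. *)
Definition sphere_domain {R : realType} (Omega : set 'rV[R]_3) : Prop :=
  [/\ Omega `<=` sphere2, Omega !=set0,
      open (Omega : set (subspace (sphere2))) & connected Omega].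

(* The argument is (polar angle, azimuth). *)
Definition spherical_param {R : realType} (p : R * R) : 'rV[R]_3 :=
  \row_(i < 3)
    [:: sin p.1 * cos p.2; sin p.1 * sin p.2; cos p.1]`_i.

Definition spherical_rect {R : realType} : set (R * R) :=
  `[0, pi] `*` `[0, 2 * pi].

(* Surface integral of the indicator function of [A]: with [p = (theta, phi)],
   the area element |d_theta X \times d_phi X| of [X := spherical_param] is
   [sin theta]. *)
Definition surface_area {R : realType} (A : set 'rV[R]_3) : \bar R :=
  (\int[lebesgue_measure \x lebesgue_measure]_(p in spherical_rect)
    (\1_A (spherical_param p) * sin p.1)%:E)%E.

Definition Lcl12 (R : realType) : \bar R :=
  (((2 * pi) ^- 2)%:E *
   \int[lebesgue_measure \x lebesgue_measure]_(xi in [set: R * R])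
     (posp (1 - (xi.1 ^+ 2 + xi.2 ^+ 2)))%:E)%E.

(* The series has nonnegative terms, so that its value in [\bar R] is always
   its actual sum. *)
Definition F_sphere2 {R : realType} (Omega : set 'rV[R]_3) (lambda : R)
    : \bar R :=
  (surface_area Omega * ((4 * pi)^-1)%:E *
   \sum_(0 <= n <oo) (posp (lambda - (n * n.+1)%:R) * (2 * n + 1)%:R)%:E)%E.

(* Main.v *)
Require Import Defs.
From HB Require Import structures.
From mathcomp Require Import all_boot all_order all_algebra.
From mathcomp Require Import all_classical all_reals all_analysis.
From mathcomp Require Import measurable_realfun.
From mathcomp Require Import ring.
Import Order.TTheory GRing.Theory Num.Theory.
Import numFieldNormedType.Exports.
Local Open Scope classical_set_scope.
Local Open Scope ring_scope.

(** The surface area is a common nonnegative factor of all the terms, so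
    everything reduces to two facts about real numbers.

    The first one is a lower bound for the Riesz mean of the eigenvalues
    n(n+1), of multiplicity 2n+1, of the Laplacian on the sphere.  Summation by
    induction gives the closed form ([sum_riesz_term_signed])

      sum_(n <= N) (lambda - n(n+1)) (2n+1)
        = lambda^2/2 + (lambda - N(N+1)) ((N+1)(N+2) - lambda) / 2.

    The remainder is nonnegative exactly when lambda lies between the
    consecutive eigenvalues N(N+1) and (N+1)(N+2), and such an N exists for
    every lambda >= 0.  As replacing each factor by its positive part only
    increases the sum, the Riesz mean is at least lambda^2/2.  For
    lambda = N(N+1) the remainder vanishes, the terms with n <= N are
    nonnegative and the later ones are cut off by the positive part, whence
    equality.

    The second one is the value 1/(8 pi) of the semiclassical constant
    ([Lcl12E]), that is, the volume pi/2 under the paraboloid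
    (1 - |xi|^2)_+.  By Tonelli's theorem this volume is the integral of its
    slices, each slice is a parabolic segment of area
    (4/3) (1 - x^2)^(3/2) ([integral_posp_parabola]), and the substitution
    x = sin t turns the integral of the slices into that of cos^4
    ([integral_cos4]). *)

(** * Positive part and surface area *)

Lemma posp_ge0 (R : realType) (x : R) : 0 <= posp x.
Proof. by rewrite /posp le_max lexx. Qed.

Lemma le_posp (R : realType) (x : R) : x <= posp x.
Proof. by rewrite /posp le_max lexx orbT. Qed.

Lemma ge0_posp (R : realType) (x : R) : 0 <= x -> posp x = x.
Proof. exact: max_r. Qed.

Lemma le0_posp (R : realType) (x : R) : x <= 0 -> posp x = 0.
Proof. exact: max_l. Qed.

(** The polar angle ranges over [0, pi], where the area element sin theta is
    nonnegative. *)
Lemma surface_area_ge0 (R : realType) (A : set 'rV[R]_3) :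
  (0 <= surface_area A)%E.
Proof.
apply: integral_ge0 => -[theta phi] [/= theta0pi _].
by rewrite lee_fin mulr_ge0// sin_ge0_pi.
Qed.

(** * Riesz mean of the spherical eigenvalues *)

Definition riesz_term {R : realType} (lambda : R) (n : nat) : R :=
  posp (lambda - (n * n.+1)%:R) * (2 * n + 1)%:R.

Lemma riesz_term_ge0 (R : realType) (lambda : R) n :
  0 <= riesz_term lambda n.
Proof. by rewrite mulr_ge0// posp_ge0. Qed.

(** Without positive parts the partial sums are quadratic in lambda, and their
    excess over lambda^2/2 factors because its discriminant is the square of
    N+1: the roots are the two consecutive eigenvalues N(N+1) and
    (N+1)(N+2).  Both claims of the theorem are read off this factorization. *)
Lemma sum_riesz_term_signed (R : realType) (lambda : R) (N : nat) :
  \sum_(0 <= n < N.+1) (lambda - (n * n.+1)%:R) * (2 * n + 1)%:R =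
  lambda ^+ 2 / 2 +
  (lambda - (N * N.+1)%:R) * ((N.+1 * N.+2)%:R - lambda) / 2.
Proof.
elim: N => [|N IHN].
  by rewrite big_nat1; field.
by rewrite big_nat_recr//= IHN; field.
Qed.

Lemma exists_eigenvalue_gap (R : realType) (lambda : R) : 0 <= lambda ->
  exists N, (N * N.+1)%:R <= lambda <= (N.+1 * N.+2)%:R.
Proof.
move=> lambda0.
have lt_ex : exists n, lambda < (n.+1 * n.+2)%:R.
  exists (Num.bound lambda); apply: (lt_le_trans (archi_boundP lambda0)).
  by rewrite ler_nat (leq_trans (leqnSn _))// leq_pmulr.
case: (ex_minnP lt_ex) => N ltN minN; exists N; rewrite (ltW ltN) andbT.
case: N ltN minN => [_ _|N _ minN]; first by rewrite mul0n.
by rewrite leNgt; apply/negP => /minN; rewrite ltnn.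
Qed.

(** Truncating the series at the gap that contains lambda and dropping the
    positive parts both decrease it, and in that gap the excess of the signed
    sum over lambda^2/2 is nonnegative. *)
Lemma riesz_mean_ge (R : realType) (lambda : R) : 0 <= lambda ->
  ((lambda ^+ 2 / 2)%:E <= \sum_(0 <= n <oo) (riesz_term lambda n)%:E)%E.
Proof.
move=> /exists_eigenvalue_gap[N /andP[leN geN]].
have nn n : (0 <= n)%N -> true -> (0 <= (riesz_term lambda n)%:E)%E.
  by rewrite lee_fin riesz_term_ge0.
apply: le_trans (@nneseries_lim_ge _ _ xpredT _ N.+1 nn).
rewrite sumEFin lee_fin.
apply: (@le_trans _ _
  (\sum_(0 <= n < N.+1) (lambda - (n * n.+1)%:R) * (2 * n + 1)%:R)).
  by rewrite sum_riesz_term_signed lerDl !mulr_ge0// subr_ge0.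
by apply: ler_sum => n _; rewrite ler_wpM2r// le_posp.
Qed.

(** At an eigenvalue N(N+1) the truncation and the removal of the positive
    parts lose nothing, and the excess has the factor lambda - N(N+1). *)
Lemma riesz_mean_eigenvalue (R : realType) (N : nat) :
  (\sum_(0 <= n <oo) (@riesz_term R (N * N.+1)%:R n)%:E =
   ((N * N.+1)%:R ^+ 2 / 2)%:E)%E.
Proof.
rewrite (@nneseries_split _ _ 0 N.+1); last first.
  by move=> n _; rewrite lee_fin riesz_term_ge0.
rewrite add0n eseries0 ?adde0; last first.
  move=> n ltNn _; rewrite /riesz_term le0_posp ?mul0r//.
  by rewrite subr_le0 ler_nat leq_mul// ltnW.
rewrite sumEFin; congr EFin.
have := sum_riesz_term_signed R (N * N.+1)%:R N.
rewrite subrr !mul0r addr0 => <-; apply: eq_big_nat => n /andP[_ leN].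
by rewrite /riesz_term ge0_posp// subr_ge0 ler_nat leq_mul.
Qed.

(** * The semiclassical constant *)

(** The fundamental theorem of calculus for a primitive known on the whole
    line, so that one-sided conditions at the end points disappear.  The
    degenerate interval a = b is allowed. *)
Lemma FTC2_derive_everywhere (R : realType) (f F : R -> R) (a b : R) :
  a <= b -> continuous f -> (forall x : R, is_derive x 1 F (f x)) ->
  (\int[lebesgue_measure]_(x in `[a, b]) (f x)%:E = (F b - F a)%:E)%E.
Proof.
move=> ab cf dF; move: ab; rewrite le_eqVlt => /predU1P[<-|ab].
  by rewrite set_itv1 integral_set1 subrr.
have cF : continuous F.
  by move=> x; exact/differentiable_continuous/derivable1_diffP.
rewrite (@continuous_FTC2 _ f F)//.
- exact: continuous_subspaceT.
- split => //.
  + by apply: cvg_at_right_filter; exact: cF.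
  + by apply: cvg_at_left_filter; exact: cF.
- by move=> x _; rewrite derive1E derive_val.
Qed.

(** For s < 0 both sides vanish, since the square root of a negative number is
    0 by convention; thus one formula covers the slices of the paraboloid that
    meet the unit disc and those that miss it. *)
Lemma integral_posp_parabola (R : realType) (s : R) :
  (\int[lebesgue_measure]_y (posp (s - y ^+ 2))%:E =
   (4 / 3 * Num.sqrt s ^+ 3)%:E)%E.
Proof.
set r := Num.sqrt s; have r0 : 0 <= r := sqrtr_ge0 s.
have [s0|s0] := leP 0 s; last first.
  rewrite /r ltr0_sqrtr// expr0n mulr0 integral0_eq// => y _.
  by rewrite le0_posp// subr_le0 (le_trans (ltW s0))// sqr_ge0.
have -> : s = r ^+ 2 by rewrite sqr_sqrtr.
transitivity (\int[lebesgue_measure]_(y in `[(- r)%R, r])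
    (r ^+ 2 - y ^+ 2)%:E)%E.
  rewrite [RHS]integral_mkcond; apply: eq_integral => y _.
  rewrite patchE mem_setE in_itv/= -ler_norml.
  have -> : (`|y| <= r) = (y ^+ 2 <= r ^+ 2).
    by rewrite -(real_normK (num_real y)) ler_pXn2r// nnegrE.
  case: ifPn => [yr|]; first by rewrite ge0_posp// subr_ge0.
  by rewrite -ltNge => /ltW ry; rewrite le0_posp// subr_le0.
have dF (y : R) : is_derive y 1 (fun y : R => r ^+ 2 * y - y ^+ 3 / 3)
    (r ^+ 2 - y ^+ 2).
  by apply: is_derive_eq; rewrite /GRing.scale/=; field.
rewrite (FTC2_derive_everywhere _ _ _ _ _ _ _ dF).
- by congr EFin; field.
- by rewrite ge0_cp.
- by move=> y; apply: cvgB; [exact: cvg_cst|exact: exprn_continuous].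
Qed.

(** The primitive comes from integrating cos^4 by parts twice. *)
Lemma integral_cos4 (R : realType) :
  (\int[lebesgue_measure]_(t in `[(- (pi / 2))%R, (pi / 2)%R])
     ((cos t : R) ^+ 4)%:E = (3 * pi / 8)%:E)%E.
Proof.
have dF (t : R) : is_derive t 1
    (fun t : R => 3 / 8 * (t + sin t * cos t) + sin t * cos t ^+ 3 / 4)
    (cos t ^+ 4).
  apply: is_derive_eq; rewrite /GRing.scale/=.
  have := cos2Dsin2 t => /(canRL (addKr _)) sin2.
  by field: sin2.
rewrite (FTC2_derive_everywhere _ _ _ _ _ _ _ dF).
- by rewrite cosN sinN cos_pihalf; congr EFin; field.
- by rewrite ge0_cp// divr_ge0// pi_ge0.
- move=> t; apply: (@continuous_comp _ _ _ cos (fun u : R => u ^+ 4)).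
    exact: continuous_cos.
  exact: exprn_continuous.
Qed.

Lemma continuous_sqrt_cube (R : realType) :
  continuous (fun x : R => Num.sqrt (1 - x ^+ 2) ^+ 3).
Proof.
move=> x.
have c : {for x, continuous (fun x : R => Num.sqrt (1 - x ^+ 2))}.
  apply: (@continuous_comp _ _ _ (fun x : R => 1 - x ^+ 2) Num.sqrt).
    by apply: cvgB; [exact: cvg_cst|exact: exprn_continuous].
  exact: sqrt_continuous.
apply: (@continuous_comp _ _ _ (fun x : R => Num.sqrt (1 - x ^+ 2))
  (fun u : R => u ^+ 3)) => //.
exact: exprn_continuous.
Qed.

(** With x = sin t the integrand becomes |cos t|^3 cos t, and cos is nonnegative
    on [- pi/2, pi/2]. *)
Lemma integral_sqrt_cube (R : realType) :
  (\int[lebesgue_measure]_(x in `[(-1 : R)%R, 1%R])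
     (Num.sqrt (1 - x ^+ 2) ^+ 3)%:E = (3 * pi / 8)%:E)%E.
Proof.
have pihalf0 : 0 <= pi / 2 :> R by rewrite divr_ge0// pi_ge0.
have sin' : derive1 (@sin R) = cos.
  by apply/funext => t; rewrite derive1E derive_val.
have := @integration_by_substitution_increasing R (@sin R)
  (fun x => Num.sqrt (1 - x ^+ 2) ^+ 3) (- (pi / 2)) (pi / 2).
rewrite sinN sin_pihalf sin' => ->.
- rewrite -integral_cos4; apply: eq_integral => t /[!inE]/= /[!in_itv]/= tI.
  congr EFin; rewrite mulrfctE/= -cos2sin2 sqrtr_sqr.
  by rewrite ger0_norm ?cos_ge0_pihalf//= -exprSr.
- by rewrite ge0_cp.
- by move=> x y xI yI; rewrite ltr_sin.
- by move=> t _; exact: continuous_cos.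
- apply/cvg_ex; exists (cos (- (pi / 2))).
  by apply: cvg_at_right_filter; exact: continuous_cos.
- apply/cvg_ex; exists (cos (pi / 2)).
  by apply: cvg_at_left_filter; exact: continuous_cos.
- split => //.
  + by apply: cvg_at_right_filter; exact: continuous_sin.
  + by apply: cvg_at_left_filter; exact: continuous_sin.
- by apply: continuous_subspaceT; exact: continuous_sqrt_cube.
Qed.

Lemma measurable_posp (R : realType) : measurable_fun setT (@posp R).
Proof. exact: (@measurable_maxr _ _ _ _ (cst 0) id). Qed.

(** Tonelli's theorem reduces the volume to the slices x = const, whose areas
    vanish outside [-1, 1]. *)
Lemma integral_posp_paraboloid (R : realType) :
  (\int[lebesgue_measure \x lebesgue_measure]_(xi in [set: R * R])
     (posp (1 - (xi.1 ^+ 2 + xi.2 ^+ 2)))%:E = (pi / 2)%:E)%E.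
Proof.
rewrite fubini_tonelli1/=; last 2 first.
- apply/measurable_EFinP; apply: measurableT_comp; first exact: measurable_posp.
  apply: measurable_funB => //; apply: measurable_funD.
    exact: measurable_funX.
  exact: measurable_funX.
- by move=> xi; rewrite lee_fin posp_ge0.
rewrite /fubini_F/=.
transitivity (\int[lebesgue_measure]_(x in `[(-1 : R)%R, 1%R])
    ((4 / 3)%:E * (Num.sqrt (1 - x ^+ 2) ^+ 3)%:E))%E.
  rewrite [RHS]integral_mkcond; apply: eq_integral => x _.
  under eq_integral do rewrite opprD addrA.
  rewrite integral_posp_parabola patchE mem_setE in_itv/= -ler_norml.
  case: ifPn => [//|]; rewrite -ltNge => x1.
  rewrite ler0_sqrtr ?expr0n ?mulr0// subr_le0 -(real_normK (num_real x)).
  by rewrite exprn_ege1// ltW.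
rewrite ge0_integralZl//.
- by rewrite integral_sqrt_cube -EFinM; congr EFin; field.
- apply/measurable_EFinP; apply: measurable_funTS.
  by apply: continuous_measurable_fun; exact: continuous_sqrt_cube.
Qed.

Lemma Lcl12E (R : realType) : Lcl12 R = ((8 * pi)^-1)%:E.
Proof.
have pi0 : pi != 0 :> R by rewrite gt_eqF// pi_gt0.
rewrite /Lcl12 integral_posp_paraboloid -EFinM; congr EFin.
(* Generalizing [pi] keeps [field] from unfolding it. *)
by move: (@pi R) pi0 => p p0; field.
Qed.

(** * The Riesz mean on a domain of the sphere *)

Lemma F_sphere2E (R : realType) (Omega : set 'rV[R]_3) (lambda : R) :
  (F_sphere2 Omega lambda = surface_area Omega *
   (((4 * pi)^-1)%:E * \sum_(0 <= n <oo) (riesz_term lambda n)%:E))%E.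
Proof. by rewrite muleA. Qed.

(** Brings the Weyl term to the shape of [F_sphere2E], where it differs only in
    the last factor.  Here [A] may be infinite. *)
Lemma weyl_termE (R : realType) (A : \bar R) (lambda : R) :
  ((((8 * pi)^-1)%:E * A * (lambda ^+ 2)%:E) =
   A * (((4 * pi)^-1)%:E * (lambda ^+ 2 / 2)%:E))%E.
Proof.
have pi0 : pi != 0 :> R by rewrite gt_eqF// pi_gt0.
rewrite [(_ * A)%E]muleC -muleA -!EFinM; congr (_ * EFin _)%E.
(* Generalizing [pi] keeps [field] from unfolding it. *)
by move: (@pi R) pi0 => p p0; field.
Qed.

Theorem corollary3p1 (R : realType) (Omega : set 'rV[R]_3)
    (hOmega : sphere_domain Omega) :
  (forall lambda : R, 0 <= lambda ->
     (((8 * pi)^-1)%:E * surface_area Omega * (lambda ^+ 2)%:E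
        <= F_sphere2 Omega lambda)%E /\
     (((8 * pi)^-1)%:E * surface_area Omega * (lambda ^+ 2)%:E
        = Lcl12 R * surface_area Omega * (lambda ^+ 2)%:E)%E) /\
  (forall (N : nat) (lambda : R), lambda = (N * N.+1)%:R ->
     F_sphere2 Omega lambda
       = (((8 * pi)^-1)%:E * surface_area Omega * (lambda ^+ 2)%:E)%E).
Proof.
split=> [lambda lambda0|N _ ->]; last first.
  by rewrite weyl_termE F_sphere2E riesz_mean_eigenvalue.
rewrite Lcl12E; split=> //; rewrite weyl_termE F_sphere2E.
apply: lee_wpmul2l; first exact: surface_area_ge0.
apply: lee_wpmul2l; last exact: riesz_mean_ge.
by rewrite lee_fin invr_ge0 mulr_ge0// pi_ge0.
Qed.
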